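(* Let Assumption 1 hold with $\delta\in(0,1]$, let $A\ge1$, define $\alpha=2L\{1-\Phi(A\sqrt{2\log L})\}+2A_0(1+A\sqrt{2\log L})^{1+\delta}/(L^{A^2-1}d_{n,\delta}^{2+\delta})$, $r=A\sqrt{2\log(L)/n}$, and assume $L\le\exp(d_{n,\delta}^2/(2A^2))$. Fix $p\in[1,\infty]$. Then with probability at least $1-\alpha$, every STIV solution $(\widehat\beta,\widehat\sigma)$ satisfies $$\big|{\bf D_X}^{-1}(\widehat\beta-\beta^* )\big|_p\le\min_{J\subseteq\{1,\dots,K\}}\max\left(\frac{2\widehat\sigma r}{\widetilde\kappa_{p,J}}\left(1-\frac{r}{\widetilde\kappa^*_{J_{\rm end},J}}-\frac{r^2}{\widetilde\kappa^*_{J^c_{\rm end},J}}\right)_+^{-1},\ \frac{6\,|({\bf D_X}^{-1}\beta^* )_{J^c}|_1}{1-c}\right).$$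
   Context: Setting: integers $n,K,L$ with $L\ge K$, $k_{\rm end}\in\{0,\dots,K\}$; observations $(y_i,x_i,z_i)$, $i=1,\dots,n$, with $y_i=x_i^T\beta^*+u_i$, $x_i\in\mathbb R^K$, $z_i\in\mathbb R^L$, the $(y_i,x_i,z_i,u_i)$ mutually independent; $J_{\rm end}=\{1,\dots,k_{\rm end}\}$, $J_{\rm end}^c$ its complement, $z_{li}=x_{(k_{\rm end}+l)i}$ for $l\le K-k_{\rm end}$. ${\bf Y},{\bf X},{\bf Z}$ the data matrices; $x_{k*}=\max_i|x_{ki}|$, $z_{l*}=\max_i|z_{li}|$; ${\bf D_X}={\rm diag}(x_{k*}^{-1})$, ${\bf D_Z}={\rm diag}(z_{l*}^{-1})$; $\Psi_n=\frac1n{\bf D_Z}{\bf Z}^T{\bf X}{\bf D_X}$; $\widehat Q(\beta)=\frac1n\sum(y_i-x_i^T\beta)^2$. $\Delta_J$ zeroes coordinates outside $J$, $J^c$ complement; $(a)_+^{-1}=1/\max(a,0)$, $a/0=\infty$ for $a>0$, $1/\infty=0$. Enlarged-cone sensitivities for $c\in(0,1)$: $\widetilde C_J=\{\Delta\in\mathbb R^K:|\Delta_{J^c}|_1\le\frac{2+c}{1-c}|\Delta_J|_1\}$, $\widetilde\kappa_{p,J}=\inf\{|\Psi_n\Delta|_\infty:\Delta\in\widetilde C_J,|\Delta|_p=1\}$, $\widetilde\kappa^*_{J_0,J}=\inf\{|\Psi_n\Delta|_\infty:\Delta\in\widetilde C_J,|\Delta_{J_0}|_1=1\}$ ($=\infty$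 if $J_0=\varnothing$). STIV estimator: any minimizer $(\widehat\beta,\widehat\sigma)$ of $|{\bf D_X}^{-1}\beta|_1+c\sigma$ over $\{(\beta,\sigma):\sigma>0,|\frac1n{\bf D_Z}{\bf Z}^T({\bf Y}-{\bf X}\beta)|_\infty\le\sigma r,\widehat Q(\beta)\le\sigma^2\}$. Assumption 1: for all $i,l$, $\mathbb E|z_{li}u_i|^{2+\delta}<\infty$, $\mathbb E[z_{li}u_i]=0$, $z_{li}u_i$ not a.s. zero; $d_{n,\delta}=\min_l\sqrt{\sum_i\mathbb E z_{li}^2u_i^2}/(\sum_i\mathbb E|z_{li}u_i|^{2+\delta})^{1/(2+\delta)}$. $\Phi$ is the standard normal cdf and $A_0$ the absolute constant of the Jing–Shao–Wang self-normalized moderate deviation bound: for independent mean-zero $X_i$ with $0<\mathbb E|X_i|^{2+\delta}<\infty$, $|\mathbb P(S_n/V_n\ge x)-(1-\Phi(x))|\le A_0(1+x)^{1+\delta}e^{-x^2/2}/d^{2+\delta}$ for $0\le x\le d$, where $S_n=\sum X_i$, $V_n^2=\sum X_i^2$, $d=(\sum\mathbb EX_i^2)^{1/2}/(\sum\mathbb E|X_i|^{2+\delta})^{1/(2+\delta)}$. *)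

(* Defs.v *)
From HB Require Import structures.
From mathcomp Require Import all_boot all_order all_algebra.
From mathcomp Require Import all_classical all_reals all_analysis.
Set Implicit Arguments. Unset Strict Implicit. Unset Printing Implicit Defensive.
Import Order.TTheory GRing.Theory Num.Theory.
Import numFieldNormedType.Exports.
Local Open Scope classical_set_scope.
Local Open Scope ring_scope.

Definition Phi {R : realType} (x : R) : R :=
  fine (normal_prob 0 1 `]-oo, x]).

Definition gen_events {d} {T : measurableType d} {R : realType}
  (G : set (T -> R)) : set (set T) :=
  <<s [set: T], [set A | exists f, G f /\ exists B : set R, measurable B /\ A = f @^-1` B] >>.

Definition mutually_independent {d} {T : measurableType d} {R : realType}
  (P : probability T R) (m : nat) (G : 'I_m -> set (T -> R)) : Prop :=
  forall A : 'I_m -> set T, (forall i, gen_events (G i) (A i)) ->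
  forall S : {set 'I_m},
    P (\bigcap_(i in [set i | i \in S]) A i) = (\prod_(i in S) P (A i))%E.

Definition lpnorm {R : realType} (m : nat) (p : \bar R) (v : 'I_m -> R) : R :=
  match p with
  | EFin q => powR (\sum_(k < m) powR `|v k| q) q^-1
  | _ => \big[Num.max/0]_(k < m) `|v k|
  end.

Definition l1norm {R : realType} (m : nat) (v : 'I_m -> R) : R :=
  \sum_(k < m) `|v k|.
Definition linfnorm {R : realType} (m : nat) (v : 'I_m -> R) : R :=
  \big[Num.max/0]_(k < m) `|v k|.

Definition restr {R : realType} (m : nat) (J : {set 'I_m}) (v : 'I_m -> R) : 'I_m -> R :=
  fun k => if k \in J then v k else 0.

Section STIV.
Context {R : realType} (n K L : nat).
(* one realisation of the data: x k i = x_{ki}, z l i = z_{li}, y i = y_i *)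
Variables (y : 'I_n -> R) (x : 'I_K -> 'I_n -> R) (z : 'I_L -> 'I_n -> R).

Definition xstar (k : 'I_K) : R := \big[Num.max/0]_(i < n) `|x k i|.
Definition zstar (l : 'I_L) : R := \big[Num.max/0]_(i < n) `|z l i|.

(** D_X^{-1} b, with D_X = diag(x_{k*}^{-1}). *)
Definition DXinv (b : 'I_K -> R) : 'I_K -> R := fun k => (xstar k)^-1^-1 * b k.

(** Psi_n Delta = (1/n) D_Z Z^T X D_X Delta. *)
Definition Psi (D : 'I_K -> R) : 'I_L -> R := fun l =>
  n%:R^-1 * \sum_(k < K) \sum_(i < n) (zstar l)^-1 * z l i * x k i * (xstar k)^-1 * D k.

Definition Qhat (b : 'I_K -> R) : R :=
  n%:R^-1 * \sum_(i < n) (y i - \sum_(k < K) x k i * b k) ^+ 2.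

(** (1/n) D_Z Z^T (Y - X b). *)
Definition score (b : 'I_K -> R) : 'I_L -> R := fun l =>
  n%:R^-1 * ((zstar l)^-1 * \sum_(i < n) z l i * (y i - \sum_(k < K) x k i * b k)).

Definition stiv_feasible (r : R) (b : 'I_K -> R) (s : R) : Prop :=
  0 < s /\ linfnorm (score b) <= s * r /\ Qhat b <= s ^+ 2.

Definition stiv_obj (c : R) (b : 'I_K -> R) (s : R) : R :=
  l1norm (DXinv b) + c * s.

Definition stiv_solution (c r : R) (b : 'I_K -> R) (s : R) : Prop :=
  stiv_feasible r b s /\
  forall b' s', stiv_feasible r b' s' -> stiv_obj c b s <= stiv_obj c b' s'.

Definition cone (c : R) (J : {set 'I_K}) (D : 'I_K -> R) : Prop :=
  l1norm (restr (~: J) D) <= (2 + c) / (1 - c) * l1norm (restr J D).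

(** tilde kappa_{p,J}  (inf of the empty set is +oo). *)
Definition kappa_p (c : R) (p : \bar R) (J : {set 'I_K}) : \bar R :=
  ereal_inf [set (linfnorm (Psi D))%:E | D in [set D | cone c J D /\ lpnorm p D = 1]].

(** tilde kappa^*_{J0,J}  (= +oo when J0 is empty, as then the set is empty). *)
Definition kappa_star (c : R) (J0 J : {set 'I_K}) : \bar R :=
  ereal_inf [set (linfnorm (Psi D))%:E | D in [set D | cone c J D /\ l1norm (restr J0 D) = 1]].
End STIV.

(** a / k for a real a >= 0 and k in [0, +oo], with a/0 = +oo for a > 0 and
    a/+oo = 0 (the paper's conventions); 0/0 is set to 0 (never relevant). *)
Definition ediv {R : realType} (a : R) (k : \bar R) : \bar R :=
  match k with
  | EFin q => if q == 0 then (if 0 < a then +oo%E else 0%E) else (a / q)%:E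
  | _ => 0%E
  end.

(** (t)_+^{-1} = 1 / max(t,0), with 1/0 = +oo. *)
Definition pos_inv {R : realType} (t : \bar R) : \bar R :=
  match t with
  | EFin q => if 0 < q then (q^-1)%:E else +oo%E
  | +oo%E => 0%E
  | -oo%E => +oo%E
  end.

Definition thm4_bound {R : realType} (n K L kend : nat) (y : 'I_n -> R)
  (x : 'I_K -> 'I_n -> R) (z : 'I_L -> 'I_n -> R) (c r : R) (p : \bar R)
  (betastar : 'I_K -> R) (sigmahat : R) (J : {set 'I_K}) : \bar R :=
  let Jend : {set 'I_K} := finset (fun k : 'I_K => (k < kend)%N) in
  maxe
   (ediv (2 * sigmahat * r) (kappa_p x z c p J) *
    pos_inv (1%:E - ediv r (kappa_star x z c Jend J)
                  - ediv (r ^+ 2) (kappa_star x z c (~: Jend) J)))%E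
   ((6 * l1norm (restr (~: J) (DXinv x betastar)) / (1 - c))%:E).

Definition d_ndelta {d} {T : measurableType d} {R : realType} (P : probability T R)
  (n L : nat) (z : 'I_L -> 'I_n -> T -> R) (u : 'I_n -> T -> R) (delta : R) : R :=
  let ratio (l : 'I_L) :=
    Num.sqrt (\sum_(i < n) fine (\int[P]_w ((z l i w * u i w) ^+ 2)%:E)) /
    powR (\sum_(i < n) fine (\int[P]_w (powR `|z l i w * u i w| (2 + delta))%:E))
         (2 + delta)^-1 in
  let s := [seq ratio l | l <- enum 'I_L] in
  \big[Num.min/head 0 s]_(v <- s) v.

(** The Jing--Shao--Wang self-normalised moderate deviation bound holds with
    constant A0 (for every probability space, every finite independent family
    of mean-zero variables with 0 < E|X_i|^{2+delta} < oo, delta in (0,1],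
    and every 0 < t <= d; S/V uses the convention a/0 = 0). *)
Definition JSW_constant {R : realType} (A0 : R) : Prop :=
  forall (d' : measure_display) (T' : measurableType d') (P' : probability T' R)
    (delta : R) (m : nat) (X : 'I_m -> T' -> R),
  0 < delta <= 1 ->
  (0 < m)%N ->
  (forall i, measurable_fun [set: T'] (X i)) ->
  mutually_independent P' (fun i => [set X i]) ->
  (forall i, (\int[P']_w (X i w)%:E = 0)%E) ->
  (forall i, (0 < \int[P']_w (powR `|X i w| (2 + delta))%:E < +oo)%E) ->
  let S w := \sum_(i < m) X i w in
  let V w := Num.sqrt (\sum_(i < m) X i w ^+ 2) in
  let dd := Num.sqrt (\sum_(i < m) fine (\int[P']_w (X i w ^+ 2)%:E)) /
            powR (\sum_(i < m) fine (\int[P']_w (powR `|X i w| (2 + delta))%:E))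
                 (2 + delta)^-1 in
  forall t, 0 < t <= dd ->
  `| fine (P' [set w | t <= S w / V w]) - (1 - Phi t) |
    <= A0 * powR (1 + t) (1 + delta) * expR (- (t ^+ 2) / 2) / powR dd (2 + delta).

(* Main.v *)
(* Put D = D_X^-1 (bhat - beta^* ) and s^* = sqrt (Qhat beta^* ). Applying the
   Jing-Shao-Wang bound to the families +-(z_li u_i)_i and a union bound over l
   gives, with probability at least 1 - alpha,
     |sum_i z_li u_i| <= A sqrt (2 log L) sqrt (sum_i z_li^2 u_i^2)  for all l,
   and on this event the rest is deterministic. There the score at beta^* is at
   most r s^*, so (beta^*, s^* ) is feasible (up to a limit when s^* = 0), and
   comparing objective values yields
     |D_X^-1 bhat|_1 + c sigmahat <= |D_X^-1 beta^*|_1 + c s^*.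
   Convexity of sqrt Qhat bounds s^* - sigmahat by |D|_1, and also by
   |D_Jend|_1 + r |D_Jend^c|_1. The first bound gives
     (1 - c) |D_J^c|_1 <= (1 + c) |D_J|_1 + 2 |(D_X^-1 beta^* )_J^c|_1,
   so that either D lies in the enlarged cone or |D|_1 is at most the second
   term of the maximum. The second bound gives
     |Psi D|_oo <= 2 sigmahat r + r |D_Jend|_1 + r^2 |D_Jend^c|_1,
   which the sensitivities turn into the first term of the maximum.
   For L = 1 one has alpha >= 1, because Phi 0 <= 1/2. *)
Require Import Defs.
From HB Require Import structures.
From mathcomp Require Import all_boot all_order all_algebra.
From mathcomp Require Import all_classical all_reals all_analysis.
From mathcomp Require Import measurable_realfun ring lra.
Import Order.TTheory GRing.Theory Num.Theory.
Import numFieldNormedType.Exports.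
Local Open Scope classical_set_scope.
Local Open Scope ring_scope.

(** * Norms on coordinate vectors *)

(** With X, Y, Z as in the proof, the squares (X b_i - Z a_i)^2 add up to X (X Y - Z^2), so dividing
    by X > 0 suffices. *)
Lemma sum_CauchySchwarz (R : rcfType) (I : finType) (a b : I -> R) :
  (\sum_i a i * b i) ^+ 2 <= (\sum_i a i ^+ 2) * (\sum_i b i ^+ 2).
Proof.
have A0 : 0 <= \sum_i a i ^+ 2 by apply: sumr_ge0 => i _; exact: sqr_ge0.
have [A_eq0|A_neq0] := eqVneq (\sum_i a i ^+ 2) 0.
  rewrite A_eq0 mul0r big1 ?expr0n// => i _.
  have /eqP : a i ^+ 2 = 0.
    by move/psumr_eq0P: A_eq0 => ->// j _; exact: sqr_ge0.
  by rewrite sqrf_eq0 => /eqP ->; rewrite mul0r.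
set X := \sum_i a i ^+ 2 in A0 A_neq0 *; set Y := \sum_i b i ^+ 2.
set Z := \sum_i a i * b i.
have : 0 <= \sum_i (X * b i - Z * a i) ^+ 2.
  by apply: sumr_ge0 => i _; exact: sqr_ge0.
have -> : \sum_i (X * b i - Z * a i) ^+ 2 = X * (X * Y - Z ^+ 2).
  transitivity (\sum_i (X ^+ 2 * b i ^+ 2 + (Z ^+ 2 * a i ^+ 2 - 2 * X * Z * (a i * b i)))).
    by apply: eq_bigr => i _; ring.
  rewrite big_split/= sumrB -!mulr_sumr -/X -/Y -/Z; ring.
by rewrite pmulr_rge0 ?subr_ge0// lt_def A_neq0.
Qed.

Section norms.
Context {R : realType} {m : nat}.
Implicit Types (v w : 'I_m -> R) (J : {set 'I_m}) (p : \bar R).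

Lemma l1norm_ge0 v : 0 <= l1norm v.
Proof. by apply: sumr_ge0. Qed.

Lemma linfnorm_ge0 v : 0 <= linfnorm v.
Proof. exact: bigmax_ge_id. Qed.

Lemma le_linfnorm v k : `|v k| <= linfnorm v.
Proof. exact: (le_bigmax _ (fun k => `|v k|)). Qed.

Lemma linfnorm_le v M : 0 <= M -> (forall k, `|v k| <= M) -> linfnorm v <= M.
Proof. by move=> M0 vM; apply: bigmax_le. Qed.

Lemma linfnormZ a v : linfnorm (fun k => a * v k) = `|a| * linfnorm v.
Proof.
rewrite /linfnorm (big_endo (fun x => `|a| * x)) ?mulr0//.
  by apply: eq_bigr => k _; rewrite normrM.
by move=> x y; rewrite maxr_pMr.
Qed.

Lemma l1normZ a v : l1norm (fun k => a * v k) = `|a| * l1norm v.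
Proof. by rewrite /l1norm mulr_sumr; apply: eq_bigr => k _; rewrite normrM. Qed.

Lemma lpnormZ p a v : (1 <= p)%E ->
  lpnorm p (fun k => a * v k) = `|a| * lpnorm p v.
Proof.
case: p => [q| |] p1; [|exact: linfnormZ..].
have q0 : q != 0 by rewrite gt_eqF// (lt_le_trans ltr01).
rewrite /lpnorm; under eq_bigr do rewrite normrM powRM//.
rewrite -mulr_sumr powRM ?powR_ge0//; last first.
  by apply: sumr_ge0 => k _; exact: powR_ge0.
by rewrite -powRrM mulfV// powRr1.
Qed.

Lemma linfnorm_le_l1norm v : linfnorm v <= l1norm v.
Proof.
apply: linfnorm_le (l1norm_ge0 v) _ => k.
by rewrite /l1norm (bigD1 k)//= lerDl sumr_ge0.
Qed.

(** For finite q and s = [l1norm v], one has |v_k|^q <= |v_k| s^(q-1); summing over k gives s^q. *)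
Lemma lpnorm_le_l1norm p v : (1 <= p)%E -> lpnorm p v <= l1norm v.
Proof.
case: p => [q| |] p1; [|exact: linfnorm_le_l1norm..].
have q1 : 1 <= q by [].
have q0 : 0 < q by rewrite (lt_le_trans ltr01).
have s0 := l1norm_ge0 v.
have le_s k : `|v k| <= l1norm v.
  exact: le_trans (le_linfnorm v k) (linfnorm_le_l1norm v).
have powq a : 0 <= a -> a `^ q = a * a `^ (q - 1).
  rewrite le_eqVlt => /predU1P[<-|a0]; first by rewrite powR0 ?mul0r ?gt_eqF.
  by rewrite -{2}(powRr1 (ltW a0)) -powRD ?(gt_eqF a0) ?implybT// addrC subrK.
rewrite /lpnorm -[leRHS]powRr1// -(mulfV (lt0r_neq0 q0)) powRrM.
apply: ge0_ler_powR; rewrite ?nnegrE ?invr_ge0 ?powR_ge0 ?(ltW q0)//.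
  by apply: sumr_ge0 => k _; exact: powR_ge0.
rewrite powq// {1}/l1norm mulr_suml; apply: ler_sum => k _.
rewrite powq// ler_wpM2l// ge0_ler_powR ?nnegrE ?subr_ge0//.
Qed.

Lemma l1norm_restrZ a J v :
  l1norm (restr J (fun k => a * v k)) = `|a| * l1norm (restr J v).
Proof.
rewrite -l1normZ; apply: eq_bigr => k _.
by rewrite /restr; case: ifP; rewrite ?mulr0.
Qed.

Lemma l1norm_restr J v : l1norm (restr J v) = \sum_(k in J) `|v k|.
Proof.
by rewrite big_mkcond/=; apply: eq_bigr => k _; rewrite /restr; case: ifP; rewrite ?normr0.
Qed.

Lemma l1norm_restrC J v : l1norm v = l1norm (restr J v) + l1norm (restr (~: J) v).
Proof.
rewrite !l1norm_restr /l1norm (bigID (mem J))/=.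
by congr (_ + _); apply: eq_bigl => k; rewrite inE.
Qed.

Lemma l1norm_restrB J v w :
  l1norm (restr J (fun k => v k - w k)) <= l1norm (restr J v) + l1norm (restr J w).
Proof.
by rewrite !l1norm_restr -big_split/=; apply: ler_sum => k _; exact: ler_normB.
Qed.

Lemma l1norm_restr_le J v w :
  l1norm (restr J v) <= l1norm (restr J (fun k => w k - v k)) + l1norm (restr J w).
Proof.
rewrite !l1norm_restr -big_split/=; apply: ler_sum => k _.
by rewrite -[in leLHS](subKr (w k) (v k)) (le_trans (ler_normB _ _))// addrC.
Qed.
End norms.

(** * Sensitivities *)

Section extended_division.
Context {R : realType}.
Implicit Types (a m N r s : R) (k : \bar R).

(* [k <= m / N] amounts to [a * N <= (a / k) * m], except that the latter
   product is meaningless when [a / k = +oo] and [m = 0]. *)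
Lemma ediv_le_mul a N m k : 0 < a -> 0 <= N -> 0 <= m -> (0 <= k)%E ->
    (0 < N -> (k <= (m / N)%:E)%E) ->
  ediv a k = +oo%E \/ exists2 e, ediv a k = e%:E & 0 <= e /\ a * N <= e * m.
Proof.
move=> a0 N0 m0 k0 kle.
have [NE0|N_gt0] : N = 0 \/ 0 < N.
- by move: N0; rewrite le_eqVlt => /predU1P[<-|]; [left|right].
- rewrite NE0 mulr0; case: k k0 {kle} => [q q0| _|//]; rewrite /ediv.
    case: eqP => _; first by rewrite a0; left.
    right; exists (a / q) => //; rewrite lee_fin in q0.
    by rewrite divr_ge0 ?(ltW a0)// mulr_ge0// divr_ge0 // ltW.
  by right; exists 0 => //; rewrite mul0r.
- move: (kle N_gt0); clear kle; case: k k0 => [q|//|//]; rewrite !lee_fin /ediv => q0 qle.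
  case: eqP => [_|/eqP qN0]; first by rewrite a0; left.
  have q_gt0 : 0 < q by rewrite lt_def qN0.
  right; exists (a / q) => //; split; first by rewrite divr_ge0 ?ltW.
  rewrite -mulrA ler_pM2l// ler_pdivlMl//.
  by rewrite -ler_pdivlMr.
Qed.

(** Used with N = |D|_p, m = |Psi D|_oo and N1, N2 the l1 norms of D on and off [Jend]. The
    sensitivities [k1], [k2] absorb r N1 + r^2 N2 into a multiple of m, and [kp] converts the
    resulting bound on m into one on N. *)
Lemma le_ediv_pos_inv a N m N1 N2 r kp k1 k2 :
    0 < a -> 0 < r -> 0 < N -> 0 <= m -> 0 <= N1 -> 0 <= N2 ->
    (0 <= kp)%E -> (0 <= k1)%E -> (0 <= k2)%E ->
    (kp <= (m / N)%:E)%E ->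
    (0 < N1 -> (k1 <= (m / N1)%:E)%E) ->
    (0 < N2 -> (k2 <= (m / N2)%:E)%E) ->
    m <= a + r * N1 + r ^+ 2 * N2 ->
  (N%:E <= ediv a kp * pos_inv (1%:E - ediv r k1 - ediv (r ^+ 2) k2))%E.
Proof.
move=> a0 r0 N0 m0 N10 N20 kp0 k10 k20 kpN k1N k2N mle.
have posinf : forall X : \bar R, (0 < X -> X * +oo = +oo)%E.
  by move=> X X0; rewrite muleC gt0_mulye.
(* The second factor is +oo, or 1/t where t = 1 - e1 - e2 > 0 satisfies t m <= a. *)
have [t tE tP] : exists2 P, pos_inv (1%:E - ediv r k1 - ediv (r ^+ 2) k2) = P &
    P = +oo%E \/ exists2 t, P = (t^-1)%:E & 0 < t /\ t * m <= a.
  eexists => //.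
  have [->|[e1 -> [e10 e1m]]] := ediv_le_mul _ _ _ _ r0 N10 m0 k10 k1N.
    by left; case: (ediv (r ^+ 2) k2).
  have [->|[e2 -> [e20 e2m]]] := ediv_le_mul _ _ _ _ (exprn_gt0 2 r0) N20 m0 k20 k2N.
    by left.
  rewrite -!EFinB /pos_inv; case: ifPn => [t0|_]; last by left.
  right; exists (1 - e1 - e2) => //; split => //; lra.
rewrite tE; have [->|[e -> [e0 em]]] := ediv_le_mul _ _ _ _ a0 (ltW N0) m0 kp0 (fun=> kpN).
  case: tP => [->|[q -> [q0 _]]]; first by rewrite mulyy leey.
  by rewrite gt0_mulye ?leey// lte_fin invr_gt0.
(* Strict positivity matters: 0 * +oo would be 0. *)
have e_gt0 : 0 < e.
  rewrite lt_def e0 andbT; apply: contraTneq em => ->.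
  by rewrite mul0r -ltNge mulr_gt0.
case: tP => [->|[q -> [q0 qm]]]; first by rewrite posinf ?leey// lte_fin.
rewrite -EFinM lee_fin ler_pdivlMr// -(ler_pM2l a0).
have : q * (a * N) <= q * (e * m) by rewrite ler_pM2l.
have : e * (q * m) <= e * a by rewrite ler_pM2l.
nra.
Qed.
End extended_division.

Section sensitivities.
Context {R : realType} {n K L : nat}.
Variables (x : 'I_K -> 'I_n -> R) (z : 'I_L -> 'I_n -> R).
Implicit Types (D : 'I_K -> R) (J : {set 'I_K}).

Lemma PsiZ a D : Psi x z (fun k => a * D k) = (fun l => a * Psi x z D l).
Proof.
apply/funext => l; rewrite /Psi mulrCA; congr (_ * _).
rewrite mulr_sumr; apply: eq_bigr => k _; rewrite mulr_sumr.
by apply: eq_bigr => i _; ring.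
Qed.

Lemma coneZ c a J D : cone c J D -> cone c J (fun k => a * D k).
Proof.
by move=> cD; rewrite /cone !l1norm_restrZ mulrCA ler_wpM2l.
Qed.

Lemma kappa_p_ge0 c p J : (0 <= kappa_p x z c p J)%E.
Proof. by apply/ereal_infP => _ [D _ <-]; rewrite lee_fin linfnorm_ge0. Qed.

Lemma kappa_star_ge0 c J0 J : (0 <= kappa_star x z c J0 J)%E.
Proof. by apply/ereal_infP => _ [D _ <-]; rewrite lee_fin linfnorm_ge0. Qed.

(** The cone is invariant under scaling and the norms are homogeneous, so D may be rescaled to unit
    p-norm. *)
Lemma kappa_p_le c p J D : (1 <= p)%E -> cone c J D -> 0 < lpnorm p D ->
  (kappa_p x z c p J <= (linfnorm (Psi x z D) / lpnorm p D)%:E)%E.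
Proof.
move=> p1 cD N0; apply: ereal_inf_lbound.
exists (fun k => (lpnorm p D)^-1 * D k).
  split; first exact: coneZ.
  by rewrite lpnormZ// ger0_norm ?invr_ge0 ?ltW// mulVf ?gt_eqF.
by rewrite PsiZ linfnormZ ger0_norm ?invr_ge0 ?(ltW N0)// mulrC.
Qed.

Lemma kappa_star_le c J0 J D : cone c J D -> 0 < l1norm (restr J0 D) ->
  (kappa_star x z c J0 J <= (linfnorm (Psi x z D) / l1norm (restr J0 D))%:E)%E.
Proof.
move=> cD N0; apply: ereal_inf_lbound.
exists (fun k => (l1norm (restr J0 D))^-1 * D k).
  split; first exact: coneZ.
  by rewrite l1norm_restrZ ger0_norm ?invr_ge0 ?ltW// mulVf ?gt_eqF.
by rewrite PsiZ linfnormZ ger0_norm ?invr_ge0 ?(ltW N0)// mulrC.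
Qed.
End sensitivities.

(** * The deterministic bound *)

Section stiv_oracle.
Context {R : realType} {n K L : nat}.
Variables (kend : nat) (y : 'I_n -> R) (x : 'I_K -> 'I_n -> R)
  (z : 'I_L -> 'I_n -> R) (u : 'I_n -> R) (bs : 'I_K -> R) (c r : R).
Hypotheses (n_gt0 : (0 < n)%N) (KL : (K <= L)%N) (c01 : 0 < c < 1).
Hypothesis yE : forall i, y i = \sum_(k < K) x k i * bs k + u i.
Hypothesis zx : forall (l : 'I_L) (k : 'I_K), (kend + l)%N = k ->
  forall i, z l i = x k i.
Hypothesis r_gt0 : 0 < r.
(** The only probabilistic input; r sqrt n is the threshold A sqrt (2 log L). *)
Hypothesis noise : forall l,
  `|\sum_(i < n) z l i * u i| <=
    r * Num.sqrt n%:R * Num.sqrt (\sum_(i < n) (z l i * u i) ^+ 2).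

Let N0 : 0 < n%:R :> R. Proof. by rewrite ltr0n. Qed.

Let mean_CauchySchwarz (a b : 'I_n -> R) :
  `|n%:R^-1 * \sum_i a i * b i| <=
  Num.sqrt (n%:R^-1 * \sum_i a i ^+ 2) * Num.sqrt (n%:R^-1 * \sum_i b i ^+ 2).
Proof.
have A0 : 0 <= \sum_i a i ^+ 2 by apply: sumr_ge0 => i _; exact: sqr_ge0.
rewrite -sqrtrM ?mulr_ge0 ?invr_ge0 ?(ltW N0)//.
rewrite -sqrtr_sqr ler_wsqrtr// mulrACA exprMn -expr2.
by rewrite ler_wpM2l ?sqr_ge0// sum_CauchySchwarz.
Qed.

Let Qs : R := Num.sqrt (Qhat y x bs).

Let Qs_ge0 : 0 <= Qs. Proof. exact: sqrtr_ge0. Qed.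

Let QhatE : Qhat y x bs = n%:R^-1 * \sum_i u i ^+ 2.
Proof.
rewrite /Qhat; congr (_ * _); apply: eq_bigr => i _.
by rewrite yE [X in X - _]addrC addrK.
Qed.

Let Qhat_ge0 b : 0 <= Qhat y x b.
Proof.
by rewrite mulr_ge0 ?invr_ge0 ?(ltW N0)// sumr_ge0// => i _; exact: sqr_ge0.
Qed.

Let sum_mul_sqr_le m (v : 'I_m -> 'I_n -> R) (a : 'I_n -> R) l :
  \sum_i (v l i * a i) ^+ 2 <= zstar v l ^+ 2 * \sum_i a i ^+ 2.
Proof.
rewrite mulr_sumr; apply: ler_sum => i _.
rewrite exprMn ler_wpM2r ?sqr_ge0// -[leLHS]real_normK ?num_real// lerXn2r ?nnegrE//.
  exact: bigmax_ge_id.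
exact: (le_bigmax _ (fun i => `|v l i|)).
Qed.

(** Pulling [zstar z l] out of the self-normaliser leaves sqrt (sum u_i^2) = sqrt n * [Qs]; the two
    factors sqrt n cancel the division by n. *)
Let z_noise l : `|n%:R^-1 * \sum_i z l i * u i| <= r * zstar z l * Qs.
Proof.
have zs0 : 0 <= zstar z l by exact: bigmax_ge_id.
have U0 : 0 <= \sum_i u i ^+ 2 by apply: sumr_ge0 => i _; exact: sqr_ge0.
rewrite normrM ger0_norm ?invr_ge0 ?(ltW N0)// ler_pdivrMl//.
apply: (le_trans (noise l)).
have -> : n%:R * (r * zstar z l * Qs) =
    r * Num.sqrt n%:R * Num.sqrt (zstar z l ^+ 2 * \sum_i u i ^+ 2).
  rewrite sqrtrM ?sqr_ge0// sqrtr_sqr ger0_norm//.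
  rewrite /Qs QhatE sqrtrM ?invr_ge0 ?(ltW N0)// sqrtrV ?(ltW N0)//.
  rewrite -{1}(sqr_sqrtr (ltW N0)).
  have : Num.sqrt n%:R != 0 :> R by rewrite gt_eqF ?sqrtr_gt0.
  by move=> ?; field.
by rewrite ler_wpM2l ?mulr_ge0 ?sqrtr_ge0 ?(ltW r_gt0)// ler_wsqrtr// sum_mul_sqr_le.
Qed.

(** Cauchy-Schwarz alone, hence valid for endogenous regressors too; the price is the missing factor
    r. *)
Let x_noise k : `|n%:R^-1 * \sum_i x k i * u i| <= xstar x k * Qs.
Proof.
have xs0 : 0 <= xstar x k by exact: bigmax_ge_id.
apply: (le_trans (mean_CauchySchwarz _ _)).
rewrite /Qs QhatE ler_wpM2r ?sqrtr_ge0//.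
rewrite -[leRHS](ger0_norm xs0) -sqrtr_sqr ler_wsqrtr// ler_pdivrMl//.
have := sum_mul_sqr_le _ x (fun=> 1) k.
under eq_bigr do rewrite mulr1.
rewrite expr1n sumr_const card_ord mulrC; exact.
Qed.

Let Jend : {set 'I_K} := finset (fun k : 'I_K => (k < kend)%N).

Let exogenous_noise k : k \notin Jend ->
  `|n%:R^-1 * \sum_i x k i * u i| <= r * xstar x k * Qs.
Proof.
rewrite inE -leqNgt => kk.
(* Regressor k is its own instrument, at the 0-based index k - kend, which is below L because K <=
   L. *)
have lL : (k - kend < L)%N.
  by rewrite (leq_ltn_trans (leq_subr _ _))// (leq_trans (ltn_ord k)).
have zxE i : z (Ordinal lL) i = x k i by apply: zx; rewrite /= subnKC.
have := z_noise (Ordinal lL).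
have -> : zstar z (Ordinal lL) = xstar x k by apply: eq_bigr => i _; rewrite zxE.
by under eq_bigr do rewrite zxE.
Qed.

(* Convexity of [b |-> sqrt (Qhat b)]: up to rescaling by [xstar], its
   gradient at [bs] is bounded coordinatewise by [w]. *)
Let sqrt_Qhat_gap (w : 'I_K -> R) b : (forall k, 0 <= w k) ->
    (forall k, `|n%:R^-1 * \sum_i x k i * u i| <= w k * xstar x k * Qs) ->
  Qs <= Num.sqrt (Qhat y x b) +
        \sum_k w k * `|DXinv x (fun k => b k - bs k) k|.
Proof.
move=> w0 wP.
have [Qs0|Qs_le0] := ltP 0 Qs; last first.
  rewrite (le_trans Qs_le0)// addr_ge0 ?sqrtr_ge0//.
  by apply: sumr_ge0 => k _; rewrite mulr_ge0.
rewrite -(ler_pM2l Qs0) mulrDr.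
pose v i := y i - \sum_k x k i * b k.
(* Expand the mean of u_i^2 using u_i = v_i + sum_k x_ki (b_k - bs_k). Cauchy-Schwarz handles the
   first term, [wP] the second. *)
have -> : Qs * Qs = n%:R^-1 * (\sum_i u i * v i) +
    \sum_k (b k - bs k) * (n%:R^-1 * \sum_i x k i * u i).
  rewrite -expr2 sqr_sqrtr// QhatE.
  under [X in _ + X]eq_bigr do rewrite mulrCA mulr_sumr.
  rewrite -mulr_sumr -mulrDr exchange_big/= -big_split/=; congr (_ * _).
  apply: eq_bigr => i _; rewrite /v yE.
  under [X in _ + X]eq_bigr do rewrite mulrA mulrC mulrBl.
  rewrite -mulr_sumr.
  have -> : \sum_k (b k * x k i - bs k * x k i) =
      \sum_k x k i * b k - \sum_k x k i * bs k.
    by rewrite -sumrB; apply: eq_bigr => k _; ring.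
  by ring.
apply: lerD.
  by rewrite (le_trans (ler_norm _))// (le_trans (mean_CauchySchwarz _ _))// -QhatE.
rewrite mulr_sumr; apply: ler_sum => k _.
rewrite (le_trans (ler_norm _))// normrM /DXinv invrK [in leRHS]normrM.
rewrite [`|xstar x k|]ger0_norm ?bigmax_ge_id//.
rewrite (le_trans (ler_wpM2l (normr_ge0 _) (wP k)))//.
by rewrite le_eqVlt; apply/orP; left; apply/eqP; ring.
Qed.

Let sqrt_Qhat_gap_l1 b :
  Qs <= Num.sqrt (Qhat y x b) + l1norm (DXinv x (fun k => b k - bs k)).
Proof.
apply: le_trans (@sqrt_Qhat_gap (fun=> 1) b (fun=> ler01) _) _ => [k|].
  by rewrite mul1r.
by rewrite lerD2l; under eq_bigr do rewrite mul1r.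
Qed.

(** Exogeneity allows the weight r off [Jend]; a further multiplication by r in [Psi_le] produces
    the r^2 of the theorem. *)
Let sqrt_Qhat_gap_end b :
  Qs <= Num.sqrt (Qhat y x b) +
    (l1norm (restr Jend (DXinv x (fun k => b k - bs k))) +
     r * l1norm (restr (~: Jend) (DXinv x (fun k => b k - bs k)))).
Proof.
pose w k := if k \in Jend then 1 else r.
have w0 k : 0 <= w k by rewrite /w; case: ifP => // _; exact: ltW.
apply: le_trans (@sqrt_Qhat_gap w b w0 _) _ => [k|].
  rewrite /w; case: ifPn => [_|]; first by rewrite mul1r.
  exact: exogenous_noise.
rewrite lerD2l (bigID (mem Jend))/= !l1norm_restr mulr_sumr; apply: lerD.
  by apply: ler_sum => k kJ; rewrite /w kJ mul1r.
rewrite [leRHS](eq_bigl (fun k => k \notin Jend)) => [|k]; last by rewrite !inE.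
by apply: ler_sum => k kJ; rewrite /w (negbTE kJ).
Qed.

Let score_bs : linfnorm (score y x z bs) <= r * Qs.
Proof.
apply: linfnorm_le => [|l]; first by rewrite mulr_ge0// ltW.
have zs0 : 0 <= zstar z l by exact: bigmax_ge_id.
have -> : score y x z bs l = (zstar z l)^-1 * (n%:R^-1 * \sum_i z l i * u i).
  rewrite /score mulrCA; congr (_ * (_ * _)); apply: eq_bigr => i _.
  by rewrite yE [X in X - _]addrC addrK.
(* Here 0^-1 = 0 makes this coordinate of the score vanish. *)
have [->|zs] := eqVneq (zstar z l) 0.
  by rewrite invr0 mul0r normr0 mulr_ge0// ltW.
have zs_gt0 : 0 < zstar z l by rewrite lt_def zs.
rewrite normrM ger0_norm ?invr_ge0// ler_pdivrMl//.
by rewrite (le_trans (z_noise l))// le_eqVlt; apply/orP; left; apply/eqP; ring.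
Qed.

(** If [xstar x k] is 0 then every x_ki is 0, which makes the convention 0^-1 = 0 harmless. *)
Let xstar_cancel k i : x k i * (xstar x k)^-1 * xstar x k = x k i.
Proof.
have [xs|xs] := eqVneq (xstar x k) 0; last by rewrite divfK.
have := le_bigmax 0 (fun i => `|x k i|) i; rewrite -/(xstar x k) xs.
by rewrite normr_le0 => /eqP ->; rewrite !mul0r.
Qed.

(** [DXinv] undoes D_X, and the residuals at [bs] and [b] differ by X (b - bs). *)
Let PsiE b l : Psi x z (DXinv x (fun k => b k - bs k)) l =
  score y x z bs l - score y x z b l.
Proof.
rewrite /Psi /score -mulrBr -mulrBr -sumrB; congr (_ * _).
rewrite exchange_big/= mulr_sumr; apply: eq_bigr => i _.
rewrite -mulrBr opprB addrC addrA subrK -sumrB !mulr_sumr; apply: eq_bigr => k _.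
rewrite /DXinv invrK -[in RHS](xstar_cancel k i); ring.
Qed.

(** * Oracle inequality for a given STIV solution *)

Variables (bh : 'I_K -> R) (sh : R).
Hypothesis sol : stiv_solution y x z c r bh sh.

Let D : 'I_K -> R := DXinv x (fun k => bh k - bs k).

Let sh_gt0 : 0 < sh. Proof. by case: sol => -[]. Qed.

Let sqrt_Qhat_bh : Num.sqrt (Qhat y x bh) <= sh.
Proof.
case: sol => -[s0 [_ Qle]] _.
by rewrite -[leRHS](ger0_norm (ltW s0)) -sqrtr_sqr ler_wsqrtr.
Qed.

(* When [Qs = 0] the pair [(bs, Qs)] is only a limit of feasible ones. *)
Let obj_le : l1norm (DXinv x bh) + c * sh <= l1norm (DXinv x bs) + c * Qs.
Proof.
have [_ opt] := sol; have /andP[c0 _] := c01.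
apply/ler_addgt0Pr => e e0.
(* Raising the scale by e / c makes it positive and costs e in the objective. *)
have ec0 : 0 < e / c by rewrite divr_gt0.
have s0 : 0 < Qs + e / c by rewrite ltr_wpDl.
have := opt bs (Qs + e / c); rewrite /stiv_obj mulrDr [c * (e / c)]mulrC divfK ?gt_eqF// addrA.
apply; split => //; split.
  by rewrite (le_trans score_bs)// mulrC ler_wpM2r ?(ltW r_gt0)// lerDl ltW.
rewrite -[leLHS]sqr_sqrtr// lerXn2r ?nnegrE ?sqrtr_ge0 ?(ltW s0)//.
by rewrite lerDl ltW.
Qed.

Let Psi_le : linfnorm (Psi x z D) <=
  2 * sh * r + r * l1norm (restr Jend D) + r ^+ 2 * l1norm (restr (~: Jend) D).
Proof.
have [[_ [scb _]] _] := sol.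
have D0 J : 0 <= l1norm (restr J D) by exact: l1norm_ge0.
apply: (@le_trans _ _ (r * Qs + sh * r)).
  apply: linfnorm_le => [|l]; first by rewrite addr_ge0// mulr_ge0// ltW.
  rewrite PsiE (le_trans (ler_normB _ _))// lerD//.
    exact: le_trans (le_linfnorm _ _) score_bs.
  exact: le_trans (le_linfnorm _ _) scb.
have : r * Qs <= r * (sh + (l1norm (restr Jend D) + r * l1norm (restr (~: Jend) D))).
  rewrite ler_pM2l// (le_trans (sqrt_Qhat_gap_end bh))//.
  by rewrite lerD2r.
by lra.
Qed.

(** In rescaled coordinates, |bs_J| <= |D_J| + |bh_J| and |D_J^c| <= |bh_J^c| + |bs_J^c|; insert
    both into [obj_le], with c (Qs - sh) <= c |D|_1. *)
Let cone_slack J : (1 - c) * l1norm (restr (~: J) D) <=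
  (1 + c) * l1norm (restr J D) + 2 * l1norm (restr (~: J) (DXinv x bs)).
Proof.
have /andP[c0 c1] := c01.
have DE : D = (fun k => DXinv x bh k - DXinv x bs k).
  by apply/funext => k; rewrite /D /DXinv mulrBr.
have gap : c * Qs <= c * (sh + l1norm D).
  rewrite ler_pM2l// (le_trans (sqrt_Qhat_gap_l1 bh))//.
  by rewrite lerD2r.
have := l1norm_restrB (~: J) (DXinv x bh) (DXinv x bs); rewrite -DE.
have := l1norm_restr_le J (DXinv x bs) (DXinv x bh); rewrite -DE.
have := l1norm_restrC J (DXinv x bs).
have := l1norm_restrC J (DXinv x bh).
move: obj_le gap; rewrite (l1norm_restrC J D); lra.
Qed.

Lemma stiv_oracle_bound p J : (1 <= p)%E ->
  ((lpnorm p D)%:E <= thm4_bound kend y x z c r p bs sh J)%E.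
Proof.
move=> p1; have /andP[c0 c1] := c01; have slack := cone_slack J.
set b := l1norm (restr (~: J) (DXinv x bs)) in slack *.
have b0 : 0 <= b by exact: l1norm_ge0.
have a0 : 0 <= l1norm (restr J D) by exact: l1norm_ge0.
have c1_gt0 : 0 < 1 - c by rewrite subr_gt0.
rewrite /thm4_bound -/Jend -/b le_max.
(* If |D_J|_1 < 2 b, then (1 - c) |D|_1 <= 2 |D_J|_1 + 2 b < 6 b, whence the constant 6. Otherwise
   |D_J|_1 absorbs 2 b, turning 1 + c into the 2 + c of the cone. *)
have [bD|Db] := leP (2 * b) (l1norm (restr J D)); last first.
  apply/orP; right; rewrite lee_fin (le_trans (lpnorm_le_l1norm _ _ p1))//.
  rewrite ler_pdivlMr// (l1norm_restrC J); nra.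
have cD : cone c J D.
  by rewrite /cone mulrAC ler_pdivlMr//; nra.
have [N_le0|N_gt0] := leP (lpnorm p D) 0.
  by apply/orP; right; rewrite lee_fin (le_trans N_le0)// divr_ge0 ?mulr_ge0// ltW.
apply/orP; left; apply: (le_ediv_pos_inv _ _ _ _ _ _ _ _ _ _ _ _ _ _ _ _ _ _ _ _ _ Psi_le);
  rewrite ?l1norm_ge0 ?linfnorm_ge0 ?kappa_p_ge0 ?kappa_star_ge0 ?mulr_gt0//.
- exact: kappa_p_le.
- exact: kappa_star_le.
- exact: kappa_star_le.
Qed.
End stiv_oracle.

(** * Self-normalised sums *)

(** The reflection t -> -t preserves the density, so both closed half-lines at 0 have equal mass;
    the point 0 is null and the masses add up to 1. *)
Lemma Phi0_le_half (R : realType) : Phi (0 : R) <= 2^-1.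
Proof.
have m_pdf (A : set R) : measurable A ->
    measurable_fun A (fun r : R => (normal_pdf 0 1 r)%:E).
  by move=> mA; apply/measurable_EFinP; apply: measurable_funS (measurable_normal_pdf 0 1).
have sym : normal_prob 0 1 `]-oo, (0 : R)] = normal_prob 0 1 `[(0 : R), +oo[.
  rewrite /normal_prob [RHS]ge0_integration_by_substitution0//; first last.
  - by move=> t; rewrite lee_fin normal_pdf_ge0.
  - exact: m_pdf.
  apply: eq_integral => t _; rewrite !normal_pdfE ?oner_neq0//.
  by rewrite /normal_fun !subr0 sqrrN.
have split0 : (normal_prob 0%R 1%R `]-oo, (0 : R)%R] +
               normal_prob 0%R 1%R `](0 : R)%R, +oo[ = 1%:E)%E.
  rewrite -measureU//.
    rewrite -[RHS](@probability_setT _ _ _ (normal_prob (0 : R) 1)); congr (_ _).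
    apply/seteqP; split => // t _ /=; rewrite !in_itv/= andbT.
    by case: (leP t 0%R); [left|right].
  apply/seteqP; split => // t []/=; rewrite !in_itv/= andbT => t0.
  by rewrite ltNge t0.
have pt : normal_prob 0 1 `](0 : R), +oo[ = normal_prob 0 1 `[(0 : R), +oo[.
  by rewrite /normal_prob integral_itv_obnd_cbnd//; exact: m_pdf.
have fin : normal_prob 0 1 `]-oo, (0 : R)] \is a fin_num by exact: fin_num_measure.
move: split0; rewrite pt -sym /Phi -(fineK fin) -EFinD => -[] /=.
lra.
Qed.

(** * Independence of variables derived from independent groups *)

Section generated_events.
Context {d : measure_display} {T : measurableType d} {R : realType}.
Implicit Types (G H : set (T -> R)) (f : T -> R).

Let gens G : set (set T) :=
  [set A | exists f, G f /\ exists B : set R, measurable B /\ A = f @^-1` B].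

(** Retyping the domain with the sigma-algebra generated by G makes the usual closure of measurable
    functions under products and opposites available. *)
Definition gen_measurable G f :=
  measurable_fun [set: g_sigma_algebraType (gens G)]
    (f : g_sigma_algebraType (gens G) -> R).

Lemma gen_measurable_mem G f : G f -> gen_measurable G f.
Proof.
move=> Gf _ B mB; rewrite setTI; apply: sub_gen_smallest.
by exists f; split => //; exists B.
Qed.

Lemma gen_events_le G H : (forall f, H f -> gen_measurable G f) ->
  gen_events H `<=` gen_events G.
Proof.
move=> HG; apply: smallest_sub; first exact: smallest_sigma_algebra.
move=> _ [f [Hf [B [mB ->]]]].
by have := HG f Hf measurableT B mB; rewrite setTI.
Qed.

Lemma mutually_independent_le (P : probability T R) m (G H : 'I_m -> set (T -> R)) :
    (forall i f, H i f -> gen_measurable (G i) f) ->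
  mutually_independent P G -> mutually_independent P H.
Proof.
by move=> HG iG A HA; apply: iG => i; apply: gen_events_le (HA i); exact: HG.
Qed.
End generated_events.

(** * Tails of self-normalised sums *)

Section self_normalized_sum.
Context {d : measure_display} {T : measurableType d} {R : realType}.
Variables (P : probability T R) (delta A0 : R).
Context {n : nat}.
Implicit Type X : 'I_n -> T -> R.

(** The d of the Jing-Shao-Wang bound for one family; [d_ndelta] is its minimum over the
    instruments. *)
Definition lyapunov_ratio X : R :=
  Num.sqrt (\sum_(i < n) fine (\int[P]_w (X i w ^+ 2)%:E)) /
  powR (\sum_(i < n) fine (\int[P]_w (powR `|X i w| (2 + delta))%:E)) (2 + delta)^-1.

Definition self_norm_tail X (t : R) : set T :=
  [set w | t <= (\sum_(i < n) X i w) / Num.sqrt (\sum_(i < n) X i w ^+ 2)].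

Record moderate_family X : Prop := ModerateFamily {
  mf_measurable : forall i, measurable_fun [set: T] (X i);
  mf_independent : mutually_independent P (fun i => [set X i]);
  mf_mean0 : forall i, (\int[P]_w (X i w)%:E = 0)%E;
  mf_moment : forall i,
    (0 < \int[P]_w (powR `|X i w| (2 + delta))%:E < +oo)%E }.

Lemma moderate_familyN X :
  moderate_family X -> moderate_family (fun i w => - X i w).
Proof.
case=> mX iX X0 Xm; split.
- by move=> i; exact: measurable_funN.
- apply: mutually_independent_le iX => i _ ->.
  by apply: measurable_funN; exact: gen_measurable_mem.
(* Integrability comes from the zero mean itself: +oo - +oo is -oo, so both parts are finite. *)
- move=> i; have := X0 i.
  rewrite [X in X = _ -> _]integralE [X in _ -> X = _]integralE.
  have -> : (fun w => (- X i w)%:E) = (fun w => - (X i w)%:E)%E by [].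
  rewrite funeposN funenegN.
  have : (0 <= \int[P]_w (fun w => (X i w)%:E)^\+ w)%E by exact: integral_ge0.
  have : (0 <= \int[P]_w (fun w => (X i w)%:E)^\- w)%E by exact: integral_ge0.
  case: (\int[P]_w (fun w => (X i w)%:E)^\+ w)%E => [a| |];
    case: (\int[P]_w (fun w => (X i w)%:E)^\- w)%E => [b| |] //= _ _.
  by rewrite -!EFinB => -[ab]; congr (_%:E); rewrite -opprB ab oppr0.
- by move=> i; under eq_integral do rewrite normrN; exact: Xm.
Qed.

Lemma lyapunov_ratioN X : lyapunov_ratio (fun i w => - X i w) = lyapunov_ratio X.
Proof.
rewrite /lyapunov_ratio; congr (Num.sqrt _ / powR _ _); apply: eq_bigr => i _;
  congr fine; apply: eq_integral => w _; by rewrite ?sqrrN ?normrN.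
Qed.

Lemma sum_sqr_eq0 X w : \sum_(i < n) X i w ^+ 2 = 0 -> \sum_(i < n) X i w = 0.
Proof.
move=> Q0; rewrite big1// => i _; apply/eqP; rewrite -sqrf_eq0; apply/eqP.
by move/psumr_eq0P: Q0 => ->// j _; exact: sqr_ge0.
Qed.

Lemma sum_sqr_ge0 X w : 0 <= \sum_(i < n) X i w ^+ 2.
Proof. by apply: sumr_ge0 => i _; exact: sqr_ge0. Qed.

Lemma self_norm_tailC X t w : ~ self_norm_tail X t w ->
  \sum_(i < n) X i w <= t * Num.sqrt (\sum_(i < n) X i w ^+ 2).
Proof.
(* When V = 0 the quotient is 0 by convention, but then every X_i vanishes as well. *)
have [Q0|Q0] := eqVneq (\sum_(i < n) X i w ^+ 2) 0.
  by rewrite (sum_sqr_eq0 _ _ Q0) Q0 sqrtr0 mulr0.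
have V0 : 0 < Num.sqrt (\sum_(i < n) X i w ^+ 2).
  by rewrite sqrtr_gt0 lt_def Q0 sum_sqr_ge0.
by move=> /negP; rewrite -ltNge ltr_pdivrMr// => /ltW.
Qed.

Lemma measurable_self_norm_tail X t : 0 < t ->
  (forall i, measurable_fun [set: T] (X i)) -> measurable (self_norm_tail X t).
Proof.
move=> t0 mX.
have mS : measurable_fun [set: T] (fun w => \sum_(i < n) X i w).
  exact: measurable_sum.
have mQ : measurable_fun [set: T] (fun w => \sum_(i < n) X i w ^+ 2).
  by apply: measurable_sum => i; exact: measurable_funX.
(* For t > 0 the event can be described without quotient or root, also where V = 0. *)
have -> : self_norm_tail X t =
    [set w | 0 < \sum_(i < n) X i w] `&`
    [set w | t ^+ 2 * \sum_(i < n) X i w ^+ 2 <= (\sum_(i < n) X i w) ^+ 2].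
  apply/seteqP; split => w /=; rewrite /self_norm_tail/=.
    have Q0 := sum_sqr_ge0 X w.
    have [Q_eq0|Q_neq0] := eqVneq (\sum_(i < n) X i w ^+ 2) 0.
      by rewrite Q_eq0 sqrtr0 invr0 mulr0 leNgt t0.
    have V0 : 0 < Num.sqrt (\sum_(i < n) X i w ^+ 2).
      by rewrite sqrtr_gt0 lt_def Q_neq0.
    rewrite ler_pdivlMr// => tVS; have tV0 := mulr_gt0 t0 V0.
    have S0 := lt_le_trans tV0 tVS; split => //.
    rewrite -{1}(sqr_sqrtr Q0) -exprMn.
    by rewrite lerXn2r ?nnegrE ?(ltW tV0) ?(ltW S0).
  case=> S0 le2; have Q0 := sum_sqr_ge0 X w.
  have [Q_eq0|Q_neq0] := eqVneq (\sum_(i < n) X i w ^+ 2) 0.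
    by rewrite (sum_sqr_eq0 _ _ Q_eq0) ltxx in S0.
  have V0 : 0 < Num.sqrt (\sum_(i < n) X i w ^+ 2).
    by rewrite sqrtr_gt0 lt_def Q_neq0.
  rewrite ler_pdivlMr// -(@ler_pXn2r _ 2)// ?nnegrE ?(ltW S0)//.
    by rewrite exprMn sqr_sqrtr.
  by rewrite mulr_ge0// ltW.
have m1 : measurable_fun [set: T] (fun w => 0 < \sum_(i < n) X i w).
  by apply: measurable_fun_ltr => //; exact: measurable_cst.
have m2 : measurable_fun [set: T] (fun w =>
    t ^+ 2 * \sum_(i < n) X i w ^+ 2 <= (\sum_(i < n) X i w) ^+ 2).
  apply: measurable_fun_ler; last exact: measurable_funX.
  by apply: measurable_funM => //; exact: measurable_cst.
have := m1 measurableT [set true] I; have := m2 measurableT [set true] I.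
by rewrite !setTI => ? ?; exact: measurableI.
Qed.

Hypotheses (d01 : 0 < delta <= 1) (n0 : (0 < n)%N) (jsw : JSW_constant A0).

Lemma self_norm_tail_le X t : moderate_family X -> 0 < t <= lyapunov_ratio X ->
  (P (self_norm_tail X t) <= (1 - Phi t +
    A0 * powR (1 + t) (1 + delta) * expR (- (t ^+ 2) / 2) /
      powR (lyapunov_ratio X) (2 + delta))%:E)%E.
Proof.
case=> mX iX X0 Xm tX; have /andP[t0 _] := tX.
have := @jsw _ _ P delta n X d01 n0 mX iX X0 Xm t tX.
rewrite -/(lyapunov_ratio X) -/(self_norm_tail X t) => /(le_trans (ler_norm _)) tail.
rewrite -[leLHS]fineK; last by rewrite fin_num_measure//; exact: measurable_self_norm_tail.
by rewrite lee_fin addrC -lerBlDr.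
Qed.

(** At t equal to the ratio, the bound reads 0 <= |...| <= A0 times a positive number. *)
Lemma JSW_constant_ge0 X : moderate_family X -> 0 < lyapunov_ratio X -> 0 <= A0.
Proof.
case=> mX iX X0 Xm D0.
have DD : 0 < lyapunov_ratio X <= lyapunov_ratio X by rewrite D0 lexx.
have := @jsw _ _ P delta n X d01 n0 mX iX X0 Xm _ DD.
move=> /(le_trans (normr_ge0 _)); rewrite -!mulrA pmulr_lge0//.
rewrite !mulr_gt0 ?invr_gt0 ?powR_gt0 ?expR_gt0//.
by rewrite ltr_wpDr ?ltW.
Qed.
End self_normalized_sum.

(** * Union bound, minimal ratio and positive moments *)

Lemma probability_bigsetU_le d (T : measurableType d) (R : realType)
    (P : probability T R) (I : finType) (F : I -> set T) :
    (forall i, measurable (F i)) ->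
  (P (\big[setU/set0]_i F i) <= \sum_i P (F i))%E.
Proof.
(* Measurability of the partial union is carried along the induction. *)
move=> mF; apply: (@proj2 (measurable (\big[setU/set0]_i F i))).
elim/big_rec2: _ => [|i s A _ [mA PA]]; first by rewrite measure0.
split; first exact: measurableU.
by apply: (le_trans (measureU2 _ _ _)) => //; rewrite leeD2l.
Qed.

Lemma d_ndelta_le d (T : measurableType d) (R : realType) (P : probability T R)
    n L (z : 'I_L -> 'I_n -> T -> R) u delta l :
  d_ndelta P z u delta <= lyapunov_ratio P delta (fun i w => z l i w * u i w).
Proof. by rewrite /d_ndelta big_map big_enum/=; exact: bigmin_le. Qed.

Lemma d_ndelta_ge0 d (T : measurableType d) (R : realType) (P : probability T R)
    n L (z : 'I_L -> 'I_n -> T -> R) u delta : 0 <= d_ndelta P z u delta.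
Proof.
rewrite /d_ndelta big_map.
have ge0 l : 0 <= lyapunov_ratio P delta (fun i w => z l i w * u i w).
  by rewrite divr_ge0 ?sqrtr_ge0 ?powR_ge0.
apply: le_bigmin => [|l _]; last exact: ge0.
by case: (enum 'I_L) => //= l s; exact: ge0.
Qed.

Lemma moment_gt0 d (T : measurableType d) (R : realType) (P : probability T R)
    (f : T -> R) q : 0 < q -> measurable_fun [set: T] f ->
    ~ {ae P, forall w, f w = 0} ->
  (0 < \int[P]_w (powR `|f w| q)%:E)%E.
Proof.
move=> q0 mf fN0.
rewrite lt0e integral_ge0 ?andbT => [|w _]; last by rewrite lee_fin powR_ge0.
apply/eqP => int0; apply: fN0.
have mg : measurable_fun [set: T] (fun w => (powR `|f w| q)%:E).
  apply/measurable_EFinP.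
  apply: (measurableT_comp (measurable_powR q)).
  by apply: (measurableT_comp _ mf); exact: normr_measurable.
have : (\int[P]_w `|(powR `|f w| q)%:E| = 0)%E.
  by under eq_integral do rewrite gee0_abs ?lee_fin ?powR_ge0//.
move/(ae_eq_integral_abs P measurableT mg).
apply: filterS => w /(_ I) /= [] /eqP.
by rewrite powR_eq0 normr_eq0 => /andP[/eqP].
Qed.

(** * Probability of the noise event and conclusion *)

Theorem theorem4 (R : realType) (d : measure_display) (T : measurableType d)
  (P : probability T R) (n K L kend : nat)
  (y : 'I_n -> T -> R) (x : 'I_K -> 'I_n -> T -> R) (z : 'I_L -> 'I_n -> T -> R)
  (u : 'I_n -> T -> R) (betastar : 'I_K -> R)
  (c delta A A0 : R) (p : \bar R) :
  (0 < n)%N -> (K <= L)%N -> (kend <= K)%N ->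
  0 < c < 1 ->
  (* random variables and the model *)
  (forall i, measurable_fun [set: T] (y i)) ->
  (forall k i, measurable_fun [set: T] (x k i)) ->
  (forall l i, measurable_fun [set: T] (z l i)) ->
  (forall i, measurable_fun [set: T] (u i)) ->
  (forall i w, y i w = \sum_(k < K) x k i w * betastar k + u i w) ->
  (* exogenous regressors are instruments: z_{l i} = x_{(kend + l) i} *)
  (forall (l : 'I_L) (k : 'I_K), (kend + l)%N = k -> forall i w, z l i w = x k i w) ->
  (* (y_i, x_i, z_i, u_i), i = 1..n, mutually independent *)
  mutually_independent P (fun i : 'I_n =>
    [set f | f = y i \/ (exists k, f = x k i) \/ (exists l, f = z l i) \/ f = u i]) ->
  (* Assumption 1 with delta in (0,1] *)
  0 < delta <= 1 ->
  (forall l i, (\int[P]_w (powR `|z l i w * u i w| (2 + delta))%:E < +oo)%E) ->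
  (forall l i, (\int[P]_w (z l i w * u i w)%:E = 0)%E) ->
  (forall l i, ~ {ae P, forall w, z l i w * u i w = 0}) ->
  (* A0 is the Jing--Shao--Wang constant *)
  JSW_constant A0 ->
  1 <= A ->
  let dnd := d_ndelta P z u delta in
  let r := A * Num.sqrt (2 * ln (L%:R) / n%:R) in
  let alpha := 2 * L%:R * (1 - Phi (A * Num.sqrt (2 * ln (L%:R))))
     + 2 * A0 * powR (1 + A * Num.sqrt (2 * ln (L%:R))) (1 + delta)
       / (powR (L%:R) (A ^+ 2 - 1) * powR dnd (2 + delta)) in
  L%:R <= expR (dnd ^+ 2 / (2 * A ^+ 2)) ->
  (1 <= p)%E ->
  exists E : set T, measurable E /\ ((1 - alpha)%:E <= P E)%E /\
    forall w, E w ->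
    forall (bhat : 'I_K -> R) (shat : R),
      stiv_solution (fun i => y i w) (fun k i => x k i w) (fun l i => z l i w) c r bhat shat ->
      ((lpnorm p (DXinv (fun k i => x k i w) (fun k => bhat k - betastar k)))%:E
       <= \big[mine/+oo%E]_(J : {set 'I_K})
            thm4_bound kend (fun i => y i w) (fun k i => x k i w) (fun l i => z l i w)
                       c r p betastar shat J)%E.
Proof.
move=> n0 KL kK c01 my mx mz mu yE zx ind d01 mom mean nz jsw A1 dnd r alpha LE p1.
have c1_gt0 : 0 < 1 - c by rewrite subr_gt0; case/andP: c01.
have q0 : 0 < 2 + delta by case/andP: d01 => d0 _; rewrite addr_gt0.
have mX l i : measurable_fun [set: T] (fun w => z l i w * u i w).
  exact: measurable_funM.
have mf l : moderate_family P delta (fun i w => z l i w * u i w).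
  split => [i||i|i]; [exact: mX| |exact: mean|].
    apply: mutually_independent_le ind => i _ ->.
    apply: measurable_funM; apply: gen_measurable_mem; first by right; right; left; exists l.
    by right; right; right.
  by rewrite mom andbT; apply: moment_gt0.
have dnd0 : 0 <= dnd by exact: d_ndelta_ge0.
(* For L = 0 the empty minimum defaults to 0, so alpha = 0 and the full space is required; K = 0
   makes the norm vanish. *)
have [L0|L_gt0] := posnP L.
  have K0 : K = 0%N by apply/eqP; rewrite -leqn0 -L0.
  exists setT; split => //; split.
    rewrite probability_setT lee_fin lerBlDr lerDl /alpha.
    have -> : dnd = 0.
      rewrite /dnd /d_ndelta; have -> : enum 'I_L = [::].
        by apply: size0nil; rewrite size_enum_ord.
      by rewrite big_nil.
    by rewrite powR0 ?gt_eqF// mulr0 invr0 mulr0 addr0 L0 mulr0 mul0r.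
  move=> w _ bh sh _; apply: le_bigmin => [|J _]; first exact: leey.
  rewrite /thm4_bound le_max; apply/orP; right; rewrite lee_fin.
  apply: (le_trans (lpnorm_le_l1norm _ _ p1)).
  rewrite /l1norm big1 => [|k _]; last by have := leq_trans (ltn_ord k) (eq_leq K0).
  by rewrite divr_ge0 ?mulr_ge0 ?(ltW c1_gt0)//; exact: l1norm_ge0.
have A0_ge0 : 0 < dnd -> 0 <= A0.
  move=> dnd_gt0; apply: (JSW_constant_ge0 _ _ _ d01 n0 jsw _ (mf (Ordinal L_gt0))).
  exact: lt_le_trans dnd_gt0 (d_ndelta_le _ _ _ _ _ _ _ _ _ _).
(* For L = 1 the threshold is 0, outside the range t > 0; alpha >= 1 makes the empty event
   enough. *)
have [L1|L1] := eqVneq L 1%N.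
  exists set0; split; first exact: measurable0.
  split => //; rewrite measure0 lee_fin subr_le0 /alpha L1 ln1 mulr0 sqrtr0 mulr0.
  rewrite -[leLHS]addr0; apply: lerD; first by have := Phi0_le_half R; lra.
  have [->|dN0] := eqVneq dnd 0.
    by rewrite powR0 ?gt_eqF// mulr0 invr0 mulr0.
  have dnd_gt0 : 0 < dnd by rewrite lt_def dN0.
  by rewrite divr_ge0 ?mulr_ge0 ?powR_ge0 ?A0_ge0.
have L2 : (1 < L)%N by rewrite ltn_neqAle eq_sym L1.
have L_gt0R : 0 < L%:R :> R by rewrite ltr0n.
have lnL : 0 < ln (L%:R : R) by rewrite ln_gt0// ltr1n.
have A_gt0 : 0 < A by rewrite (lt_le_trans ltr01).
set t := A * Num.sqrt (2 * ln (L%:R)) in alpha *.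
have t0 : 0 < t by rewrite mulr_gt0 ?sqrtr_gt0 ?mulr_gt0.
have t2 : t ^+ 2 = 2 * (A ^+ 2 * ln L%:R).
  by rewrite exprMn sqr_sqrtr ?mulr_ge0 ?(ltW lnL)//; ring.
have r0 : 0 < r by rewrite mulr_gt0// sqrtr_gt0 divr_gt0 ?mulr_gt0 ?ltr0n.
have rt : r * Num.sqrt n%:R = t.
  rewrite /r -mulrA -sqrtrM ?divr_ge0 ?mulr_ge0 ?(ltW lnL)//.
  by rewrite divfK// gt_eqF// ltr0n.
(* The assumption on L, after taking logarithms, is exactly t^2 <= dnd^2. *)
have tdnd : t <= dnd.
  rewrite -(@ler_pXn2r _ 2)// ?nnegrE ?(ltW t0)// t2.
  move: LE; rewrite -[X in X <= _](@lnK _ L%:R)// ler_expR.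
  by rewrite ler_pdivlMr ?mulr_gt0 ?exprn_gt0//; lra.
have dnd_gt0 := lt_le_trans t0 tdnd; have A00 := A0_ge0 dnd_gt0.
set q := 1 - Phi t + A0 * powR (1 + t) (1 + delta) * expR (- (t ^+ 2) / 2) /
  powR dnd (2 + delta).
have alphaE : alpha = L%:R * (q + q).
  (* Since t^2 / 2 = A^2 log L, the Gaussian factor is L^(-A^2). *)
  have LexpE : L%:R * expR (- (t ^+ 2) / 2) = (powR L%:R (A ^+ 2 - 1))^-1.
    rewrite -powRN opprB powRD ?(gt_eqF L_gt0R) ?implybT// powRr1 ?ltW//.
    rewrite /powR (gt_eqF L_gt0R) t2; congr (_ * expR _); by field.
  rewrite /alpha /q invfM -LexpE; ring.
(* Replacing each ratio by the minimum [dnd] only enlarges the error term, as A0 >= 0. *)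
have tail_le (X : 'I_n -> T -> R) : moderate_family P delta X -> dnd <= lyapunov_ratio P delta X ->
    (P (self_norm_tail X t) <= q%:E)%E.
  move=> mfX dX.
  have tX : 0 < t <= lyapunov_ratio P delta X by rewrite t0 (le_trans tdnd).
  apply: (le_trans (self_norm_tail_le _ _ _ d01 n0 jsw _ _ mfX tX)).
  rewrite lee_fin lerD2l ler_wpM2l ?mulr_ge0 ?powR_ge0 ?expR_ge0//.
  rewrite lef_pV2 ?posrE ?powR_gt0 ?(lt_le_trans dnd_gt0)//.
  by rewrite ge0_ler_powR ?nnegrE ?(ltW q0) ?(le_trans dnd0).
pose X l i w := z l i w * u i w.
pose F l := self_norm_tail (X l) t `|` self_norm_tail (fun i w => - X l i w) t.
have mF l : measurable (F l).
  apply: measurableU; apply: measurable_self_norm_tail => // i; first exact: mX.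
  exact: measurable_funN (mX l i).
have PF l : (P (F l) <= (q + q)%:E)%E.
  apply: (le_trans (measureU2 _ _ _)).
  - by apply: measurable_self_norm_tail => // i; exact: mX.
  - by apply: measurable_self_norm_tail => // i; exact: measurable_funN (mX l i).
  rewrite EFinD; apply: leeD; apply: tail_le.
  - exact: mf.
  - exact: d_ndelta_le.
  - exact: moderate_familyN (mf l).
  - by rewrite (lyapunov_ratioN P delta (X l)); exact: d_ndelta_le.
have mU : measurable (\big[setU/set0]_l F l) by exact: bigsetU_measurable.
exists (~` \big[setU/set0]_l F l); split; first exact: measurableC.
split.
  (* L instruments with two tails of mass at most q each: 2 L q = alpha. *)
  rewrite probability_setC// EFinB leeB//.
  apply: (le_trans (probability_bigsetU_le _ _ _ _ _ _ mF)).
  apply: (@le_trans _ _ (\sum_(l < L) (q + q)%:E)%E); first exact: lee_sum.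
  by rewrite sumEFin lee_fin sumr_const card_ord alphaE mulr_natl.
move=> w Ew bh sh sol; apply: le_bigmin => [|J _]; first exact: leey.
have NF l : ~ F l w.
  by move=> Fw; apply: Ew; rewrite (bigD1 l)//=; left.
apply: (stiv_oracle_bound _ _ _ _ (u ^~ w) _ _ _ n0 KL c01 _ _ r0 _ _ _ sol) => //.
  by move=> l k lk i; exact: zx.
(* The upper bound comes from the tail of X, the lower one from the tail of -X. *)
move=> l; rewrite rt ler_norml lerNl; apply/andP; split; last first.
  by apply: (self_norm_tailC (X l)) => Fw; apply: (NF l); left.
have := self_norm_tailC (fun i w => - X l i w) t w.
have -> : \sum_(i < n) (- X l i w) ^+ 2 = \sum_(i < n) X l i w ^+ 2.
  by apply: eq_bigr => i _; rewrite sqrrN.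
rewrite sumrN.
by apply => Fw; apply: (NF l); right.
Qed.
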